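(* Let $\mathcal{E}$ denote the end space of an orientable 2-manifold $S$. Then $\mathcal{E}$ is self-similar if and only if $\mathcal{E}$ has radial symmetry.
   Context: A 2-manifold is a connected, second countable, Hausdorff topological space in which every point has a neighborhood homeomorphic to $\mathbb{R}^2$ (in particular, without boundary). An exiting sequence in $S$ is a sequence $\{U_n\}_{n\in\mathbb{N}}$ of open subsets of $S$ with compact boundary such that $U_{n+1}\subset U_n$ for each $n$ and such that for every compact $K\subset S$ there is $N\in\mathbb{N}$ with $U_N\cap K=\varnothing$. Two exiting sequences $\{U_n\}$ and $\{V_n\}$ are equivalent if for every $n$ there exists $m$ such that $U_m\subset V_n$ and $V_m\subset U_n$. An end of $S$ is an equivalence class of exiting sequences, and the end space $\mathcal{E}$ is the set of ends, topologized with basis the sets $\widehat V=\{[\{U_n\}]\in\mathcal{E} : U_n\subset V \text{ for some } n\}$, where $V\subset S$ is open with compact boundary. An end $[\{U_n\}]$ is planar if some $U_n$ is homeomorphic to an open subset of $\mathbb{R}^2$, and non-planar otherwise; $\mathcal{E}_{np}\subset\mathcal{E}$ denotes the closed subset of non-planar ends. Every subset $A\subset\mathcal{E}$ is regarded as a pair $(A,A\cap\mathcal{E}_{np})$, and all homeomorphisms are homeomorphisms of pairs: ''$A$ and $B$ are homeomorphic'' means there is a homeomorphism $A\to B$ mapping $A\cap\mathcal{E}_{np}$ onto $B\cap\mathcal{E}_{np}$. $\mathcal{E}$ is self-similar if, given pairwise-disjoint clopen subsets $\mathcal{E}_1,\dots,\mathcal{E}_n$ such that $\mathcal{E}=\mathcal{E}_1\sqcup\cdots\sqcup\mathcal{E}_n$,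 there exist $i\in\{1,\dots,n\}$ and $A\subset\mathcal{E}_i$ such that $A$ is open and homeomorphic to $\mathcal{E}$. $\mathcal{E}$ has radial symmetry if either $\mathcal{E}$ is a singleton, or there exist a point $x\in\mathcal{E}$ and a collection of pairwise homeomorphic, non-compact sets $\{E_n\}_{n\in\mathbb{N}}$ such that the closure of $E_n$ is disjoint from $E_m$ whenever $n\neq m$ and such that $\mathcal{E}\setminus\{x\}=\bigsqcup_{n\in\mathbb{N}}E_n$.
   Formalization: Exiting sequences are required to have connected, nonempty terms; in radial symmetry the union of the E_n is a topological disjoint union (each E_n is open); in self-similarity n = 0 is allowed, so that an empty end space is not self-similar. *)

(* Defs.v *)
From HB Require Import structures.
From mathcomp Require Import all_boot all_order all_algebra.
From mathcomp Require Import all_classical all_reals all_analysis.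

Set Implicit Arguments.
Unset Strict Implicit.
Unset Printing Implicit Defensive.

Import Order.TTheory GRing.Theory Num.Theory numFieldNormedType.Exports.

Local Open Scope classical_set_scope.
Local Open Scope ring_scope.

Definition boundary (X : topologicalType) (A : set X) : set X :=
  closure A `\` interior A.

(* [f] and [g] are total functions, but only their restrictions to [A] and [B]
   matter: [{within A, continuous f}] is continuity for the topology induced
   on [A]. *)
Definition is_homeo (X Y : topologicalType) (A : set X) (B : set Y)
    (f : X -> Y) (g : Y -> X) : Prop :=
  [/\ forall x, A x -> B (f x) /\ g (f x) = x,
      forall y, B y -> A (g y) /\ f (g y) = y,
      {within A, continuous f} & {within B, continuous g}].

Definition homeomorphic (X Y : topologicalType) (A : set X) (B : set Y) : Prop :=
  exists (f : X -> Y) (g : Y -> X), is_homeo A B f g.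

(* [A] is the topological disjoint union (coproduct) of the subsets [F i]: they
   partition [A], and each of them is open in the subspace [A]. *)
Definition topological_disjoint_union (X : topologicalType) (I : Type)
    (A : set X) (F : I -> set X) : Prop :=
  [/\ \bigcup_i F i = A,
      trivIset setT F &
      forall i, exists2 O : set X, open O & F i = A `&` O].

(* Surfaces; the plane is [R * R] with its product topology. *)

Definition two_manifold (R : realType) (S : topologicalType) : Prop :=
  [/\ connected [set: S],
      @second_countable S,
      hausdorff_space S &
      forall x : S, exists2 N : set S, nbhs x N & homeomorphic N [set: R * R]].

Definition closed_disc (R : realType) (p : R * R) (r : R) : set (R * R) :=
  [set q | (q.1 - p.1) ^+ 2 + (q.2 - p.2) ^+ 2 <= r ^+ 2].

Definition polar (R : realType) (r t : R) : R * R := (r * cos t, r * sin t).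

(* The loop [w], parametrized by [0, 2pi], has winding number 1 around the
   origin: it has a continuous argument [theta] which increases by [2 pi]. *)
Definition winds_once (R : realType) (w : R -> R * R) : Prop :=
  exists theta : R -> R,
    [/\ {within `[0, 2 * pi], continuous theta},
        forall t : R, 0 <= t <= 2 * pi ->
          exists2 rho : R, 0 < rho & w t = polar rho (theta t) &
        theta (2 * pi) = theta 0 + 2 * pi].

(* For [h] an open embedding of an open set [A] of the plane into the plane:
   the image under [h] of every counterclockwise circle bounding a disc in [A]
   has winding number 1 around the image of the centre of the circle, i.e. [h]
   has local degree 1 everywhere on [A]. *)
Definition orientation_preserving (R : realType) (A : set (R * R))
    (h : R * R -> R * R) : Prop :=
  forall (p : R * R) (r : R), 0 < r -> closed_disc p r `<=` A ->
    winds_once (fun t =>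
      let c := polar r t in
      let q := h (p.1 + c.1, p.2 + c.2) in
      (q.1 - (h p).1, q.2 - (h p).2)).

(* Existence of an atlas all of whose transition maps preserve orientation. *)
Definition orientable (R : realType) (S : topologicalType) : Prop :=
  exists (I : Type) (D : I -> set S)
         (phi : I -> S -> R * R) (psi : I -> R * R -> S),
    [/\ forall i, [/\ open (D i), open (phi i @` D i) &
                      is_homeo (D i) (phi i @` D i) (phi i) (psi i)],
        \bigcup_i D i = setT &
        forall i j, orientation_preserving
          (phi i @` (D i `&` D j)) (phi j \o psi i)].

(* The terms of an exiting sequence are required to be connected and nonempty.
   Without these conditions the equivalence classes below would be the closed
   subsets of the space of ends (the empty one included) instead of its
   points. *)
Record exiting_seq (S : topologicalType) := ExitingSeq {
  exit_set :> nat -> set S;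
  exit_open : forall n, open (exit_set n);
  exit_boundary : forall n, compact (boundary (exit_set n));
  exit_connected : forall n, connected (exit_set n);
  exit_nonempty : forall n, exit_set n !=set0;
  exit_decr : forall n, exit_set n.+1 `<=` exit_set n;
  exit_leaves : forall K : set S, compact K ->
    exists N, exit_set N `&` K = set0
}.

HB.instance Definition _ (S : topologicalType) := gen_eqMixin (exiting_seq S).
HB.instance Definition _ (S : topologicalType) :=
  gen_choiceMixin (exiting_seq S).

Lemma exit_le (S : topologicalType) (U : exiting_seq S) (m n : nat) :
  (m <= n)%N -> U n `<=` U m.
Proof.
elim: n => [|n IHn]; first by rewrite leqn0 => /eqP ->.
rewrite leq_eqVlt => /orP[/eqP -> //|]; rewrite ltnS => /IHn.
by apply: subset_trans; exact: exit_decr.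
Qed.

Definition exit_equiv (S : topologicalType) (U V : exiting_seq S) : Prop :=
  forall n, exists m, U m `<=` V n /\ V m `<=` U n.

Definition exit_equivb (S : topologicalType) : rel (exiting_seq S) :=
  fun U V => `[< exit_equiv U V >].

Lemma exit_equivb_equiv (S : topologicalType) :
  equiv_class_of (@exit_equivb S).
Proof.
have tr (U V W : exiting_seq S) : exit_equiv U V -> exit_equiv V W ->
    forall n, exists k, U k `<=` W n.
  move=> UV VW n; have [m [VWm _]] := VW n; have [k [UVk _]] := UV m.
  by exists k; exact: subset_trans VWm.
have sym (U V : exiting_seq S) : exit_equiv U V -> exit_equiv V U.
  by move=> UV n; have [m [? ?]] := UV n; exists m.
split.
- by move=> U; apply/asboolP => n; exists n; split; exact: subset_refl.
- by move=> U V; apply/asboolP/asboolP => /sym.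
- move=> V U W /asboolP UV /asboolP VW; apply/asboolP => n.
  have [k kP] := tr _ _ _ UV VW n.
  have [l lP] := tr _ _ _ (sym _ _ VW) (sym _ _ UV) n.
  exists (maxn k l); split.
    by apply: subset_trans kP; apply: exit_le; exact: leq_maxl.
  by apply: subset_trans lP; apply: exit_le; exact: leq_maxr.
Qed.

Canonical exit_equivb_rel (S : topologicalType) :=
  EquivRelPack (exit_equivb_equiv S).

Definition end_space (S : topologicalType) : Type :=
  {eq_quot @exit_equivb S}%qT.

HB.instance Definition _ (S : topologicalType) := Choice.on (end_space S).

Definition end_class (S : topologicalType) (U : exiting_seq S) : end_space S :=
  (\pi_({eq_quot @exit_equivb S}) U)%qT.

Definition end_nbhd (S : topologicalType) (V : set S) : set (end_space S) :=
  [set e | exists U : exiting_seq S, e = end_class U /\ exists n, U n `<=` V].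

Definition compact_boundary_open (S : topologicalType) : set (set S) :=
  [set V | open V /\ compact (boundary V)].

Lemma end_classP (S : topologicalType) (U V : exiting_seq S) :
  end_class U = end_class V <-> exit_equiv U V.
Proof.
split=> [/eqquotP/asboolP //|UV].
by apply/eqquotP/asboolP.
Qed.

Lemma end_nbhd_cover (S : topologicalType) :
  \bigcup_(V in @compact_boundary_open S) end_nbhd V = setT.
Proof.
apply/seteqP; split=> // e _; exists setT.
  split; first exact: openT.
  by rewrite /boundary interiorT setDT; exact: compact0.
by exists (repr e); split; [rewrite /end_class reprK|exists 0%N].
Qed.

Lemma end_nbhd_join (S : topologicalType) (V W : set S) (e : end_space S) :
  compact_boundary_open V -> compact_boundary_open W ->
  end_nbhd V e -> end_nbhd W e ->
  exists Z, [/\ compact_boundary_open Z, end_nbhd Z e &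
                end_nbhd Z `<=` end_nbhd V `&` end_nbhd W].
Proof.
move=> [oV cV] [oW cW] [U [-> [n UV]]] [U' [/end_classP UU' [n' UW]]].
exists (V `&` W); split.
- split; first exact: openI.
  apply: (@subclosed_compact _ _ (boundary V `|` boundary W)).
  + rewrite /boundary setDE; apply: closedI; first exact: closed_closure.
    by apply: open_closedC; exact: open_interior.
  + exact: compactU.
  + rewrite /boundary interiorI => x [cx nx].
    have xV : closure V x by apply: (@closureS _ (V `&` W)) cx => ? [].
    have xW : closure W x by apply: (@closureS _ (V `&` W)) cx => ? [].
    have [iV|niV] := pselect (interior V x); last by left.
    by right; split=> // iW; exact: nx.
- exists U; split=> //; have [m [Um _]] := UU' n'; exists (maxn n m).
  move=> x Ux; split; first by apply: UV; apply: exit_le Ux; exact: leq_maxl.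
  by apply: UW; apply: Um; apply: exit_le Ux; exact: leq_maxr.
- by move=> _ [T [-> [k Tk]]]; split; exists T; split=> //; exists k => x /Tk[].
Qed.

HB.instance Definition _ (S : topologicalType) :=
  @isBaseTopological.Build (end_space S) (set S)
    (@compact_boundary_open S) (@end_nbhd S)
    (@end_nbhd_cover S) (@end_nbhd_join S).

Definition planar_end (R : realType) (S : topologicalType) (e : end_space S)
    : Prop :=
  exists U : exiting_seq S, e = end_class U /\
    exists (n : nat) (W : set (R * R)), open W /\ homeomorphic (U n) W.

Definition nonplanar_ends (R : realType) (S : topologicalType)
    : set (end_space S) :=
  [set e | ~ planar_end R e].

Definition ends_homeomorphic (R : realType) (S : topologicalType)
    (A B : set (end_space S)) : Prop :=
  exists f g : end_space S -> end_space S, is_homeo A B f g /\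
    f @` (A `&` @nonplanar_ends R S) = B `&` @nonplanar_ends R S.

(* [n = 0] is allowed: it makes the empty end space of a compact surface not
   self-similar, and is vacuous for all other end spaces. *)
Definition self_similar (R : realType) (S : topologicalType) : Prop :=
  forall (n : nat) (F : 'I_n -> set (end_space S)),
    (forall i, clopen (F i)) -> trivIset setT F -> \bigcup_i F i = setT ->
    exists (i : 'I_n) (A : set (end_space S)),
      [/\ A `<=` F i, open A & ends_homeomorphic R A setT].

(* The decomposition of the complement of [x] is a disjoint union of spaces.
   For a mere partition into sets, the ordinal [omega * 2 + 1] would qualify:
   the complement of one of its two limit points is partitioned by infinitely
   many infinite closed discrete sets. *)
Definition radially_symmetric (R : realType) (S : topologicalType) : Prop :=
  (exists x : end_space S, [set: end_space S] = [set x]) \/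
  exists (x : end_space S) (F : nat -> set (end_space S)),
    [/\ forall n m, ends_homeomorphic R (F n) (F m),
        forall n, ~ compact (F n),
        forall n m : nat, n != m -> closure (F n) `&` F m = set0 &
        topological_disjoint_union (~` [set x]) F].

(* Main.v *)
Require Import Defs.
From mathcomp Require Import all_boot all_order all_algebra.
From mathcomp Require Import all_classical all_reals all_analysis.

(** The space of ends of a surface is compact and Hausdorff, and each end has
a countable basis of clopen neighbourhoods; the theorem holds for every such
space X with a distinguished subset P.

From radial symmetry to self-similarity: let X \ {x} be the disjoint union of
open sets F_n, all homeomorphic, and let V be a clopen neighbourhood of x, for
instance the part containing x of a clopen partition. Then V itself is
homeomorphic to X ([radial_clopen_nbhd]). By compactness all but finitely many
F_n lie in V, and grouping the F_n into finite blocks one gets a decomposition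
of X \ {x} into homeomorphic open blocks G_0, G_1, ... such that only G_0 may
leave V. Each G_k contains a copy of K = G_0 \ V; moving the copy in G_k onto
the copy in G_(k+1) pushes K into V, and gives a homeomorphism of X \ {x} with
V \ {x}. It extends over x because X and V are the one-point compactifications
of these two spaces ([one_point_extension]).

From self-similarity to radial symmetry: compactness provides a star point x,
one all of whose neighbourhoods contain an open copy of X
([self_similar_star_point]). Hence every clopen set which misses x has copies
which are arbitrarily close to x and miss x ([star_point_copy]), and one can
choose clopen neighbourhoods V_n shrinking to x such that U_n = V_n \ V_(n+1)
embeds in U_(n+1) ([nested_copies]). These embeddings together form an open
embedding T of Z = X \ {x} in itself, under which every point moves towards x,
so that Z is the disjoint union of the homeomorphic open sets T^m (Z \ T Z)
([shift_orbit]). Distributing these countably many sets into infinitely many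
infinite families gives the required homeomorphic, non-compact sets
([star_point_radial]).

The topology of the space of ends is elementary except for its compactness
([end_space_compact]), which rests on the connectedness of the surface: over
an exhaustion by compact sets M_n, every end lies in a component of the
complement of M_n which meets the boundary of any compact neighbourhood of
M_n. An ultrafilter of ends transported to that compact boundary accumulates
at a point, and so selects one component for each n; these components form an
exiting sequence, and its end is the limit of the ultrafilter. *)

Set Implicit Arguments.
Unset Strict Implicit.
Unset Printing Implicit Defensive.

Import numFieldNormedType.Exports.

Local Open Scope classical_set_scope.

(** * Finite subfamilies of covers of compact sets *)

Lemma compact_increasing_cover (X : topologicalType) (K : set X)
    (O : nat -> set X) :
  compact K -> (forall n, open (O n)) -> {homo O : m n / (m <= n)%N >-> m `<=` n} ->
  K `<=` \bigcup_n O n -> exists n, K `<=` O n.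
Proof.
move=> /compact_near_coveringP cK oO incr cov.
have [|N _ NK] := cK nat \oo O _.
  move=> x /cov[n _ Onx].
  have nO : nbhs x (O n) by exact: open_nbhs_nbhs.
  suff : filter_prod (nbhs x) \oo (fun p => O p.2 p.1) by [].
  exists (O n, [set m | (n <= m)%N]); first by split=> //; exists n.
  by case=> y m /= [Ony nm]; exact: (incr n m nm).
by exists N; apply: NK => /=.
Qed.

(** If no finite family covered [K], the complements of the finite unions would
generate a proper filter on [K]; an accumulation point [y] of it would have to
avoid its own neighbourhood [U y]. *)
Lemma compact_finite_cover (X : topologicalType) (K : set X)
    (U : X -> set X) :
  compact K -> (forall x, nbhs x (U x)) ->
  exists s : seq X, forall y, K y -> exists2 x, x \in s & U x y.
Proof.
move=> cK nU; apply: contrapT => /forallNP noc.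
pose W (s : seq X) := [set y | K y /\ forall x, x \in s -> ~ U x y].
pose F := filter_from [set: seq X] W.
have FF : ProperFilter F.
  apply: filter_from_proper.
    apply: filter_from_filter; first by exists [::].
    move=> s t _ _; exists (s ++ t) => // y [Ky yst].
    by split; split=> // x xs; apply: yst; rewrite mem_cat xs ?orbT.
  move=> s _; have /existsNP[y /not_implyP[Ky ny]] := noc s.
  by exists y; split=> // x xs Uxy; apply: ny; exists x.
have [|y [Ky cy]] := cK F FF; first by exists [::] => // y [].
have [|z [[_ zU] Uz]] := cy (W [:: y]) (U y) _ (nU y); first by exists [:: y].
by apply: zU Uz; rewrite inE.
Qed.

(** * Homeomorphisms of pairs between open sets *)

(** On open sets the continuity of a restriction is plain continuity at the
points of the set, which makes restricting and gluing easier. The sets [A] and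
[B] stand for the pairs [(A, A `&` P)] and [(B, B `&` P)]. *)
Definition pair_homeo (X : topologicalType) (P A B : set X) (f g : X -> X) :=
  [/\ open A, open B,
      forall x, A x -> [/\ B (f x), g (f x) = x, P (f x) <-> P x &
                          continuous_at x f] &
      forall y, B y -> [/\ A (g y), f (g y) = y & continuous_at y g]].

Definition pair_homeomorphic (X : topologicalType) (P A B : set X) :=
  exists f g, pair_homeo P A B f g.

Section PairHomeo.
Context (X : topologicalType) (P : set X).
Implicit Types (A B C : set X) (f g : X -> X).

Lemma pair_homeo_sym A B f g : pair_homeo P A B f g -> pair_homeo P B A g f.
Proof.
move=> [oA oB fP gP]; split=> // [y By|x Ax]; last by have [? ? _ ?] := fP x Ax.
have [Agy fgy cg] := gP y By; split=> //.
by have [_ _ + _] := fP _ Agy; rewrite fgy => <-.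
Qed.

Lemma pair_homeomorphic_refl A : open A -> pair_homeomorphic P A A.
Proof.
by move=> oA; exists id, id; split=> // x Ax; split=> //; exact: cvg_id.
Qed.

Lemma pair_homeomorphic_sym A B :
  pair_homeomorphic P A B -> pair_homeomorphic P B A.
Proof. by move=> [f [g /pair_homeo_sym fg]]; exists g, f. Qed.

Lemma pair_homeo_comp A B C f g h k :
  pair_homeo P A B f g -> pair_homeo P B C h k ->
  pair_homeo P A C (h \o f) (g \o k).
Proof.
move=> [oA oB fP gP] [_ oC hP kP]; split=> // [x Ax|z Cz] /=.
  have [Bfx gfx Pfx cf] := fP x Ax; have [Chx khx Phx ch] := hP _ Bfx.
  split=> //; first by rewrite khx.
    by rewrite Phx.
  exact: continuous_comp.
have [Bkz hkz ck] := kP z Cz; have [Agy fgy cg] := gP _ Bkz.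
by split=> //; [rewrite fgy|exact: continuous_comp].
Qed.

Lemma pair_homeomorphic_trans A B C : pair_homeomorphic P A B ->
  pair_homeomorphic P B C -> pair_homeomorphic P A C.
Proof.
move=> [f [g fg]] [h [k hk]]; exists (h \o f), (g \o k).
exact: pair_homeo_comp fg hk.
Qed.

Lemma pair_homeo_sub A B f g A' : pair_homeo P A B f g -> open A' ->
  A' `<=` A -> pair_homeo P A' (f @` A') f g.
Proof.
move=> [oA oB fP gP] oA' A'A; split=> //.
- have -> : f @` A' = B `&` g @^-1` A'.
    apply/seteqP; split=> [_ [x A'x <-]|y [By A'gy]].
      by have [? gfx _ _] := fP x (A'A _ A'x); split=> //=; rewrite gfx.
    by exists (g y) => //; have [_ ->] := gP y By.
  apply: (continuous_inP g oB).1 => // y /[!inE] By.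
  by have [] := gP y By.
- move=> x A'x; have [? ? ? ?] := fP x (A'A _ A'x).
  by split=> //; exists x.
- move=> _ [x A'x <-]; have [Bfx gfx _ _] := fP x (A'A _ A'x).
  by rewrite gfx; split=> //; have [] := gP _ Bfx.
Qed.

Definition piecewise (A : nat -> set X) (f : nat -> X -> X) (x : X) : X :=
  f (xget 0%N [set n | A n x]) x.

Lemma piecewiseE (A : nat -> set X) (f : nat -> X -> X) n x :
  trivIset setT A -> A n x -> piecewise A f x = f n x.
Proof.
move=> tA Anx; rewrite /piecewise; congr (f _ x).
case: xgetP => [m _ Amx|/(_ n)//]; apply: tA => //.
by exists x.
Qed.

Lemma piecewise_homeo (A B : nat -> set X) (f g : nat -> X -> X) :
  trivIset setT A -> trivIset setT B ->
  (forall n, pair_homeo P (A n) (B n) (f n) (g n)) ->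
  pair_homeo P (\bigcup_n A n) (\bigcup_n B n) (piecewise A f) (piecewise B g).
Proof.
move=> tA tB fg.
have glue_cts (C : nat -> set X) h n x : trivIset setT C -> open (C n) -> C n x ->
    continuous_at x (h n) -> continuous_at x (piecewise C h).
  move=> tC oC Cx; rewrite /continuous_at (piecewiseE _ tC Cx).
  apply: cvg_trans; apply: near_eq_cvg.
  have /filterS : nbhs x (C n) by exact: open_nbhs_nbhs.
  by apply=> y Cy; rewrite (piecewiseE _ tC Cy).
split.
- by apply: bigcup_open => n _; have [] := fg n.
- by apply: bigcup_open => n _; have [] := fg n.
- move=> x [n _ Ax]; have [oA oB fP gP] := fg n; rewrite (piecewiseE _ tA Ax).
  have [Bfx gfx Pfx cf] := fP x Ax; rewrite (piecewiseE _ tB Bfx).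
  by split=> //; [exists n|exact: glue_cts cf].
- move=> x [n _ Bx]; have [oA oB fP gP] := fg n; rewrite (piecewiseE _ tB Bx).
  have [Agx fgx cg] := gP x Bx; rewrite (piecewiseE _ tA Agx).
  by split=> //; [exists n|exact: glue_cts cg].
Qed.

Lemma bigcup_homeomorphic (A B : nat -> set X) :
  trivIset setT A -> trivIset setT B ->
  (forall n, pair_homeomorphic P (A n) (B n)) ->
  pair_homeomorphic P (\bigcup_n A n) (\bigcup_n B n).
Proof.
move=> tA tB /choice[f /choice[g fg]].
by exists (piecewise A f), (piecewise B g); exact: piecewise_homeo.
Qed.

Lemma setU_homeomorphic A B A' B' : A `&` B = set0 -> A' `&` B' = set0 ->
  pair_homeomorphic P A A' -> pair_homeomorphic P B B' ->
  pair_homeomorphic P (A `|` B) (A' `|` B').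
Proof.
move=> AB AB' hA hB; rewrite -!bigcup2E; apply: bigcup_homeomorphic.
- by rewrite -trivIset_bigcup2.
- by rewrite -trivIset_bigcup2.
- move=> [|[|n]] //=; exact/pair_homeomorphic_refl/open0.
Qed.

Hypothesis hX : hausdorff_space X.

(** For compact [A] and [B] the extension over [x] needs no metric information:
for an open neighbourhood [N] of [y], the set [B `\` N] is compact and misses
[y], so its preimage is compact, hence closed, and misses [x]. *)
Lemma one_point_extension A B x y :
  compact A -> compact B -> open A -> open B -> A x -> B y -> (P y <-> P x) ->
  pair_homeomorphic P (A `\ x) (B `\ y) -> pair_homeomorphic P A B.
Proof.
move=> cA cB oA oB Ax By Pxy [f [g fg]].
pose ext (a b : X) (h : X -> X) z := if z == a then b else h z.
have extP C D a b h k : compact D -> open C -> D b -> C a ->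
    pair_homeo P (C `\ a) (D `\ b) h k -> (P b <-> P a) ->
    forall z, C z -> [/\ D (ext a b h z), ext b a k (ext a b h z) = z,
        P (ext a b h z) <-> P z & continuous_at z (ext a b h)].
  move=> cD oC Db Ca [oCa _ hP kP] Pab z Cz.
  have extb (c d : X) l w : w != c -> ext c d l w = l w by rewrite /ext => /negPf->.
  have exta (c d : X) l : ext c d l c = d by rewrite /ext eqxx.
  have [->|za] := eqVneq z a; last first.
    have [|[Dhz /eqP hzb] khz Phz ch] := hP z; first by split=> //; exact/eqP.
    split; rewrite ?extb//.
    rewrite /continuous_at extb//; apply: cvg_trans ch; apply: near_eq_cvg.
    have /filterS : nbhs z (C `\ a).
      by apply: open_nbhs_nbhs; split=> //; split=> //; exact/eqP.
    by apply=> w [_ /eqP wa]; rewrite extb.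
  split; rewrite ?exta//.
  rewrite /continuous_at exta => N /nbhs_interior.
  set O := interior N => bO.
  have cK : compact (k @` (D `&` ~` O)).
    apply: continuous_compact.
      apply: continuous_in_subspaceT => w /[!inE] -[Dw Ow].
      have [|//] := kP w; split=> // wb; apply: Ow; rewrite wb.
      exact: nbhs_singleton.
    by apply: compact_closedI => //; apply: open_closedC; exact: open_interior.
  have nK : ~ (k @` (D `&` ~` O)) a.
    move=> [w [Dw Ow] kwa]; have [|[_ +] _ _] := kP w; last exact.
    by split=> // wb; apply: Ow; rewrite wb; exact: nbhs_singleton.
  have : nbhs a (C `&` ~` (k @` (D `&` ~` O))).
    apply: open_nbhs_nbhs; split=> //; apply: openI => //.
    by apply: closed_openC; exact: compact_closed.
  apply: filterS => w [Cw nKw]; rewrite /= /ext.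
  have [_|wa] := eqVneq w a.
    by apply: interior_subset; exact: nbhs_singleton bO.
  apply: interior_subset; apply: contrapT => Ow; apply: nKw.
  have [|[Dhw _] khw _ _] := hP w; first by split=> //; exact/eqP.
  by exists (h w).
have fP := extP _ _ _ _ _ _ cB oA By Ax fg Pxy.
have gP := extP _ _ _ _ _ _ cA oB Ax By (pair_homeo_sym fg) (iff_sym Pxy).
exists (ext x y f), (ext y x g); split=> // z /gP[? ? _ ?]; by split.
Qed.

End PairHomeo.

(** * Radial symmetry implies self-similarity *)

Section RadialToSelfSimilar.
Context (X : topologicalType) (P : set X).
Hypothesis cX : compact [set: X].
Hypothesis hX : hausdorff_space X.

Definition pair_self_similar :=
  forall (n : nat) (F : 'I_n -> set X),
    (forall i, clopen (F i)) -> trivIset setT F -> \bigcup_i F i = setT ->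
    exists i A, A `<=` F i /\ pair_homeomorphic P A setT.

Definition radial_decomposition (x : X) (F : nat -> set X) :=
  [/\ forall n, open (F n), trivIset setT F, \bigcup_n F n = ~` [set x] &
      forall n m, pair_homeomorphic P (F n) (F m)].

(** An Eilenberg swindle: the finitely many summands which leave [V] are put into
the block [G 0], and [K], the part of [G 0] outside [V], is absorbed by
shifting its copies [f k @` K] from each block [G k] to the next one. *)
Lemma radial_clopen_nbhd x F V : radial_decomposition x F ->
  clopen V -> V x -> pair_homeomorphic P V setT.
Proof.
move=> [oF tF covF hF] [oV cV] Vx.
have [N VN] : exists N, ~` V `<=` \bigcup_(i in `I_N) F i.
  apply: compact_increasing_cover.
  - apply: subclosed_compact cX _ => //; exact: open_closedC.
  - by move=> n; apply: bigcup_open.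
  - by move=> m n mn; apply: bigcup_subset => i /= im; exact: leq_trans mn.
  - move=> z Vz; have : (~` [set x]) z by move=> /= zx; apply: Vz; rewrite zx.
    by rewrite -covF => -[n _ Fnz]; exists n.+1 => //; exists n => /=.
(* The blocks have length [N.+1] rather than [N], so as not to be empty; [Gf k]
   is padded with empty sets to make [G k] a union over all of [nat]. *)
pose Gf k i := if (i < N.+1)%N then F (k * N.+1 + i)%N else set0.
have GfF k i z : Gf k i z -> (i < N.+1)%N /\ F (k * N.+1 + i)%N z.
  by rewrite /Gf; case: ifP.
pose G k := \bigcup_i Gf k i.
have oG k : open (G k).
  by apply: bigcup_open => i _; rewrite /Gf; case: ifP => _ //; exact: open0.
have tGf k : trivIset setT (Gf k).
  move=> i j _ _ [z [/GfF[_ Fi] /GfF[_ Fj]]].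
  by apply: (@addnI (k * N.+1)); apply: tF => //; exists z.
have tG : trivIset setT G.
  move=> k l _ _ [z [[i _ /GfF[iN Fi]] [j _ /GfF[jN Fj]]]].
  have : (k * N.+1 + i)%N = (l * N.+1 + j)%N by apply: tF => //; exists z.
  by move=> /(congr1 (divn^~ N.+1)); rewrite !divnMDl// !divn_small// !addn0.
have covG : \bigcup_k G k = ~` [set x].
  rewrite -covF; apply/seteqP; split=> z.
    by move=> [k _ [i _ /GfF[_ Fz]]]; exists (k * N.+1 + i)%N.
  move=> [n _ Fz]; exists (n %/ N.+1) => //; exists (n %% N.+1) => //.
  by rewrite /Gf ltn_mod /= -divn_eq.
have hG k : pair_homeomorphic P (G 0%N) (G k).
  apply: bigcup_homeomorphic => // i; rewrite /Gf; case: ifP => _ //.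
  exact/pair_homeomorphic_refl/open0.
have GV k : G k.+1 `<=` V.
  move=> z [i _ /GfF[iN Fz]]; apply: contrapT => /VN[j /= jN Fj].
  have jE : j = (k.+1 * N.+1 + i)%N by apply: tF => //; exists z.
  by move: jN; rewrite jE mulSn -addnA => /ltnW; rewrite leqNgt ltnS leq_addr.
have /choice[f /choice[g fg]] := hG.
pose K := G 0%N `&` ~` V; pose L := G 0%N `&` V.
have oK : open K by apply: openI => //; exact: closed_openC.
have oL : open L by exact: openI.
have KG : K `<=` G 0%N by move=> z [].
have LG : L `<=` G 0%N by move=> z [].
have fK k : pair_homeo P K (f k @` K) (f k) (g k) by exact: pair_homeo_sub (fg k) _ _.
have fL k : pair_homeo P L (f k @` L) (f k) (g k) by exact: pair_homeo_sub (fg k) _ _.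
have fG k z : G 0%N z -> G k (f k z) by move=> Gz; have [_ _ /(_ _ Gz)[]] := fg k.
have Gf_inv k z : G k z -> exists2 w, G 0%N w & f k w = z.
  by move=> Gz; have [_ _ _ /(_ _ Gz)[]] := fg k; exists (g k z).
have f_inj k w w' : G 0%N w -> G 0%N w' -> f k w = f k w' -> w = w'.
  have [_ _ fP _] := fg k.
  by move=> /fP[_ e _ _] /fP[_ e' _ _] ff'; rewrite ff' e' in e.
have fKG k : f k @` K `<=` G k by move=> _ [z /KG Gz <-]; exact: fG.
have fLG k : f k @` L `<=` G k by move=> _ [z /LG Gz <-]; exact: fG.
(* In the block [G 0], the part of [V `\ x] is [L] itself, and not [f 0 @` L]. *)
pose L' k := if k is 0%N then L else f k @` L.
have L'G k : L' k `<=` G k by case: k => [|k] //; exact: fLG.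
have triv_sub (H : nat -> set X) : (forall k, H k `<=` G k) -> trivIset setT H.
  by move=> HG i j _ _ [z [/HG Gi /HG Gj]]; apply: tG => //; exists z.
have disj i j : f i @` L `&` f j @` K = set0.
  apply/seteqP; split=> // z [Lz Kz].
  have ij : i = j by apply: tG => //; exists z; split; [exact: fLG|exact: fKG].
  move: Lz Kz; rewrite ij => -[w [Gw Vw] <-] [w' [Gw' nVw']].
  by move=> /(f_inj _ _ _ Gw' Gw) ww'; apply: nVw'; rewrite ww'.
apply: (@one_point_extension _ P hX V setT x x) => //.
- by apply: subclosed_compact cX _.
- exact: openT.
apply: pair_homeomorphic_sym.
have -> : setT `\ x = \bigcup_k (f k @` L) `|` \bigcup_k (f k @` K).
  rewrite setTD -covG; apply/seteqP; split=> z.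
    move=> [k _ /Gf_inv[w Gw <-]]; have [Vw|Vw] := pselect (V w).
      by left; exists k => //; exists w.
    by right; exists k => //; exists w.
  by case=> -[k _]; [move/fLG|move/fKG] => Gz; exists k.
have -> : V `\ x = \bigcup_k L' k `|` \bigcup_k (f k.+1 @` K).
  apply/seteqP; split=> z.
    move=> [Vz zx]; have : (~` [set x]) z by [].
    rewrite -covG => -[[|k] _ Gz]; first by left; exists 0%N.
    have [w Gw <-] := Gf_inv _ _ Gz; have [Vw|Vw] := pselect (V w).
      by left; exists k.+1 => //; exists w.
    by right; exists k => //; exists w.
  move=> zLK; suff [k Gz Vz] : exists2 k, G k z & V z.
    by split=> //; have : (\bigcup_k G k) z by [exists k]; rewrite covG.
  case: zLK => -[k _]; last by move=> /fKG Gz; exists k.+1 => //; exact: GV Gz.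
  case: k => [[Gz Vz]|k /fLG Gz]; first by exists 0%N.
  by exists k.+1 => //; exact: GV Gz.
apply: setU_homeomorphic.
- apply/seteqP; split=> // z [[i _ Lz] [j _ Kz]].
  by have : set0 z by rewrite -(disj i j).
- apply/seteqP; split=> // z [[[|i] _ Lz] [j _ Kz]]; last first.
    by have : set0 z by rewrite -(disj i.+1 j.+1).
  suff : 0%N = j.+1 by [].
  by apply: tG => //; exists z; split; [exact: LG|exact: fKG].
- apply: bigcup_homeomorphic; [exact: triv_sub|exact: triv_sub|move=> k].
  apply: (@pair_homeomorphic_trans _ _ _ L).
    by apply: pair_homeomorphic_sym; exists (f k), (g k).
  case: k => [|k]; first exact: pair_homeomorphic_refl.
  by exists (f k.+1), (g k.+1); exact: fL.
- apply: bigcup_homeomorphic; first exact: triv_sub.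
    move=> i j _ _ [z [/fKG Gi /fKG Gj]]; apply: succn_inj.
    by apply: tG => //; exists z.
  move=> k; apply: (@pair_homeomorphic_trans _ _ _ K).
    by apply: pair_homeomorphic_sym; exists (f k), (g k).
  by exists (f k.+1), (g k.+1).
Qed.

Lemma radial_self_similar x F : radial_decomposition x F -> pair_self_similar.
Proof.
move=> rF n E cE tE covE; have [i _ Eix] : (\bigcup_i E i) x by rewrite covE.
exists i, (E i); split=> //.
exact: radial_clopen_nbhd rF (cE i) Eix.
Qed.

End RadialToSelfSimilar.

(** * Self-similarity implies radial symmetry *)

Section ShiftOrbit.
Context (X : topologicalType) (P : set X).

(** [Z `\` Z'] is a fundamental domain for [T : Z -> Z']. A point of [U n] lies in
the image of at most the [n]-th iterate of [T], since [T] raises the level [n]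
by one; so every point reaches the domain after finitely many steps back. *)
Lemma shift_orbit (Z Z' : set X) (T S : X -> X) (U : nat -> set X) :
  pair_homeo P Z Z' T S -> Z' `<=` Z -> open (Z `\` Z') ->
  trivIset setT U -> \bigcup_n U n = Z ->
  (forall n z, U n z -> U n.+1 (T z)) ->
  let D m := iter m T @` (Z `\` Z') in
  [/\ trivIset setT D, \bigcup_m D m = Z &
      forall m, pair_homeomorphic P (D 0%N) (D m)].
Proof.
move=> TS Z'Z oD tU covU TU D.
have [oZ oZ' TP SP] := TS.
have DS m : D m.+1 = T @` D m.
  by rewrite /D image_comp.
have DZ m : D m `<=` Z.
  elim: m => [|m IH]; first by move=> _ [z [Zz _] <-].
  by rewrite DS => _ [z /IH /TP[Z'Tz _ _ _] <-]; exact: Z'Z.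
have oDm m : open (D m).
  elim: m => [|m IH]; first by rewrite /D image_id.
  by rewrite DS; have [] := pair_homeo_sub TS IH (@DZ m).
split.
- suff disj m n z : D m z -> D (m + n.+1)%N z -> False.
    move=> m n _ _ [z [Dm Dn]]; case: (ltngtP m n) => // mn.
      by case: (disj m (n - m.+1)%N z) => //; rewrite addnS -addSn subnKC.
    by case: (disj n (m - n.+1)%N z) => //; rewrite addnS -addSn subnKC.
  elim: m z => [|m IH] z.
    rewrite add0n DS {1}/D image_id => -[_ Z'z] [w /DZ/TP[Z'Tw _ _ _]].
    by move=> Twz; apply: Z'z; rewrite -Twz.
  rewrite addSn !DS => -[w Dw <-] [w' Dw' TT].
  have [_ Sw _ _] := TP _ (DZ _ _ Dw); have [_ Sw' _ _] := TP _ (DZ _ _ Dw').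
  by apply: (IH w) => //; rewrite -Sw -TT Sw'.
- apply/seteqP; split=> [z [m _ /DZ]//|].
  (* Induction on the level: either [z] is in the domain, or it is [T (S z)], and
     [S z] is one level lower. *)
  suff lev n z : U n z -> (\bigcup_m D m) z.
    by move=> z; rewrite -covU => -[n _ /lev].
  elim: n z => [|n IH] z Uz.
    have [Z'z|nZ'z] := pselect (Z' z).
      have [/= Sz TSz _] := SP z Z'z; move: Sz; rewrite -covU => -[m _ USz].
      suff : 0%N = m.+1 by [].
      by apply: tU => //; exists z; split=> //; rewrite -TSz; exact: TU.
    by exists 0%N => //; rewrite /D image_id; split=> //; rewrite -covU; exists 0%N.
  have [Z'z|nZ'z] := pselect (Z' z); last first.
    by exists 0%N => //; rewrite /D image_id; split=> //; rewrite -covU; exists n.+1.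
  have [/= Sz TSz _] := SP z Z'z; move: (Sz); rewrite -covU => -[m _ USz].
  have nm : n = m.
    apply: succn_inj; apply: tU => //; exists z; split=> //.
    by rewrite -TSz; exact: TU.
  have [k _ DSz] : (\bigcup_m D m) (S z) by apply: IH; rewrite nm.
  by exists k.+1 => //; rewrite DS; exists (S z).
- elim=> [|m IH]; first exact: pair_homeomorphic_refl.
  apply: pair_homeomorphic_trans IH _; rewrite DS; exists T, S.
  exact: pair_homeo_sub TS (oDm m) (@DZ m).
Qed.

End ShiftOrbit.

Section SelfSimilarToRadial.
Context (X : topologicalType) (P : set X).
Hypothesis cX : compact [set: X].
Hypothesis hX : hausdorff_space X.
Hypothesis bX : forall x, exists B : nat -> set X,
  [/\ forall n, clopen (B n), forall n, B n x &
      forall N, nbhs x N -> exists n, B n `<=` N].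

Lemma open_setC1 (x : X) : open (~` [set x]).
Proof.
by apply: closed_openC; exact: accessible_closed_set1 (hausdorff_accessible hX) x.
Qed.

Lemma clopen_nbhd (x : X) (N : set X) : nbhs x N -> exists V, [/\ clopen V, V x & V `<=` N].
Proof.
by have [B [cB Bx BN]] := bX x; move=> /BN[n BnN]; exists (B n).
Qed.

Definition star_point (x : X) := forall N, nbhs x N ->
  exists A, A `<=` N /\ pair_homeomorphic P A setT.

(** Otherwise [X] is covered by finitely many clopen sets without an open copy of
[X]; made disjoint, they form a clopen partition which contradicts
self-similarity. *)
Lemma self_similar_star_point : pair_self_similar P -> exists x, star_point x.
Proof.
move=> ss; apply: contrapT => nostar.
have /choice[U UP] x : exists U, [/\ clopen U, U x &
    forall A, A `<=` U -> ~ pair_homeomorphic P A setT].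
  have /existsNP[N /not_implyP[xN noN]] : ~ star_point x.
    by move=> sx; apply: nostar; exists x.
  have [V [cV Vx VN]] := clopen_nbhd xN; exists V; split=> // A AV hA.
  by apply: noN; exists A; split=> //; exact: subset_trans VN.
have [x|s scov] := @compact_finite_cover _ setT U cX.
  by have [[oU _] Ux _] := UP x; exact: open_nbhs_nbhs.
pose G := nth set0 [seq U x | x <- s].
have cG j : clopen (G j).
  rewrite /G; have [js|sj] := ltnP j (size s); last first.
    by rewrite nth_default ?size_map//; exact: clopen0.
  case: s {scov G} js => [//|x0 s] js.
  by rewrite (nth_map x0)//; have [] := UP (nth x0 (x0 :: s) j).
have [|||i [A [AF hA]]] := ss (size s) (fun i => seqDU G i).
- move=> i; rewrite /seqDU setDE; apply: clopenI => //; apply: clopenC => //.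
  by apply: (big_ind clopen); [exact: clopen0|exact: clopenU|].
- move=> i j _ _ ij; apply: val_inj => /=.
  exact: (trivIset_seqDU G).
- rewrite -subTset => y _; have [x xs Uxy] := scov y I.
  have : (\big[setU/set0]_(k < size s) G k) y.
    rewrite -bigcup_mkord; exists (index x s); first by rewrite /= index_mem.
    by rewrite /G (nth_map x) ?index_mem// nth_index.
  rewrite bigsetU_seqDU -bigcup_mkord => -[k /= ks Gk].
  by exists (Ordinal ks).
have AG : A `<=` G i by apply: subset_trans AF _; exact: subset_seqDU.
move: AG; rewrite /G; case: s {scov G cG AF} i => [[]//|x0 s] i.
rewrite (nth_map x0)//; have [_ _ noA] := UP (nth x0 (x0 :: s) i).
by move=> /noA.
Qed.

(** A copy [h X] of [X] in [V] contains the copy [h U] of [U], which can only be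
used if it misses [x]. If it contains [x], then [h] moves [x], because [U]
misses [x]; so [h] takes points near [x] away from [x], and it is enough to
precompose [h] with a copy of [X] close to [x]. *)
Lemma star_point_copy (x : X) (U V : set X) : star_point x -> clopen U -> ~ U x -> nbhs x V ->
  exists f g, [/\ pair_homeo P U (f @` U) f g, f @` U `<=` V & ~ (f @` U) x].
Proof.
move=> sx [oU cU] Ux xV.
have [A [AV [g [h gh]]]] := sx V xV.
have hg := pair_homeo_sym gh; have [_ oA hP gP] := hg.
have [xhU|] := pselect ((h @` U) x); last first.
  exists h, g; split=> //; first exact: pair_homeo_sub hg oU _.
  by move=> _ [z _ <-]; apply: AV; have [] := hP z I.
have hx : h x <> x.
  case: xhU => u Uu huz hxx; apply: Ux.
  have [_ gh1 _ _] := hP u I; have [_ gh2 _ _] := hP x I.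
  by rewrite -gh2 hxx -huz gh1.
have xN : nbhs x (h @^-1` (~` [set x])).
  have [_ _ _ ch] := hP x I; apply: ch; apply: open_nbhs_nbhs; split=> //.
  exact: open_setC1.
have [A' [A'N [g' [h' gh']]]] := sx _ xN.
have hg' := pair_homeo_sym gh'; have [_ oA' hP' gP'] := hg'.
have hA' := pair_homeo_sub hg oA' (@subsetT _ A').
have hh := pair_homeo_comp hg' hA'.
exists (h \o h'), (g' \o g); split.
- exact: pair_homeo_sub hh oU _.
- by move=> _ [z _ <-] /=; apply: AV; have [] := hP (h' z) I.
- move=> [z _ /= hhz]; have [A'z _ _ _] := hP' z I.
  exact: A'N A'z hhz.
Qed.

(** Dependent choice of clopen neighbourhoods of [x]: given [V n.+1], copy [U n]
into it; the copy is compact and misses [x], so it also misses some smaller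
[V n.+2], and then lies in [U n.+1]. *)
Lemma nested_copies x (V1 : set X) : star_point x -> clopen V1 -> V1 x ->
  exists (V : nat -> set X) (f g : nat -> X -> X),
  [/\ V 0%N = setT /\ V 1%N = V1,
      forall n, [/\ clopen (V n), V n x & V n.+1 `<=` V n],
      forall N, nbhs x N -> exists n, V n `<=` N &
      forall n, let U m := V m `\` V m.+1 in
        pair_homeo P (U n) (f n @` U n) (f n) (g n) /\ f n @` U n `<=` U n.+1].
Proof.
move=> sx cV1 V1x; have [B [cB Bx BN]] := bX x.
(* The choice of the next set depends on the two last ones. *)
pose state := (set X * set X)%type.
pose valid (p : state) := [/\ clopen p.1, clopen p.2, p.2 `<=` p.1, p.1 x & p.2 x].
pose step (q : state * nat) (r : set X * ((X -> X) * (X -> X))) :=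
  let U := q.1.1 `\` q.1.2 in valid q.1 ->
  [/\ clopen r.1, r.1 x, r.1 `<=` q.1.2 `&` B q.2,
      pair_homeo P U (r.2.1 @` U) r.2.1 r.2.2 & r.2.1 @` U `<=` q.1.2 `\` r.1].
have /choice[next nextP] q : exists r, step q r.
  have [|nv] := pselect (valid q.1); last by exists (set0, (id, id)).
  case: q => -[V V'] n [/= cV cV' V'V Vx V'x].
  have cU : clopen (V `\` V').
    by rewrite setDE; apply: clopenI => //; exact: clopenC.
  have [f [g [fg fV' fx]]] : exists f g, [/\ pair_homeo P (V `\` V')
      (f @` (V `\` V')) f g, f @` (V `\` V') `<=` V' & ~ (f @` (V `\` V')) x].
    apply: star_point_copy => //; first by case.
    by apply: open_nbhs_nbhs; split=> //; case: cV'.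
  have clf : closed (f @` (V `\` V')).
    apply: compact_closed => //; apply: continuous_compact.
      apply: continuous_in_subspaceT => z /[!inE] Uz.
      by have [_ _ /(_ z Uz)[]] := fg.
    by apply: subclosed_compact cX _ => //; case: cU.
  have [W [cW Wx WN]] : exists W, [/\ clopen W, W x &
      W `<=` V' `&` B n `&` ~` (f @` (V `\` V'))].
    apply: clopen_nbhd; apply: open_nbhs_nbhs; split=> //.
    apply: openI; last exact: closed_openC.
    by apply: openI; [case: cV'|case: (cB n)].
  exists (W, (f, g)); rewrite /step /= => _; split=> //.
    by move=> z /WN[].
  move=> z fz; split; first exact: fV'.
  by move=> /WN[_]; exact.
pose st := fix st n : state := if n is m.+1
  then ((st m).2, (next (st m, m)).1) else (setT, V1).
have stv n : valid (st n).
  elim: n => [|n IH]; first by split=> //; exact: clopenT.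
  have [cW Wx WV _ _] := nextP (st n, n) IH; have [_ ? _ _ ?] := IH.
  by split=> //= z /WV[].
exists (fun n => (st n).1), (fun n => (next (st n, n)).2.1),
  (fun n => (next (st n, n)).2.2); split=> //.
- by move=> n; have [] := stv n.
- move=> N /BN[n BnN]; exists n.+2; apply: subset_trans BnN => z /=.
  by have [_ _ WV _ _] := nextP (st n, n) (stv n); move=> /WV[].
- by move=> n /=; have [_ _ _ ? ?] := nextP (st n, n) (stv n).
Qed.

Lemma star_point_radial x y : star_point x -> y <> x ->
  exists2 F, radial_decomposition P x F & forall n, ~ compact (F n).
Proof.
move=> sx yx.
have [V1 [cV1 V1x V1y]] : exists V1, [/\ clopen V1, V1 x & V1 `<=` ~` [set y]].
  apply: clopen_nbhd; apply: open_nbhs_nbhs; split; last exact: nesym.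
  exact: open_setC1.
have [V [f [g [[V0 V1E] VP VN fgU]]]] := nested_copies sx cV1 V1x.
pose U n := V n `\` V n.+1.
have Vle m n : (m <= n)%N -> V n `<=` V m.
  elim: n => [|n IH]; first by rewrite leqn0 => /eqP->.
  rewrite leq_eqVlt => /orP[/eqP->//|]; rewrite ltnS => /IH.
  by apply: subset_trans; have [] := VP n.
have tU : trivIset setT U.
  move=> m n _ _ [z [[Vm Vm1] [Vn Vn1]]]; case: (ltngtP m n) => // mn.
    by case: Vm1; exact: Vle mn _ Vn.
  by case: Vn1; exact: Vle mn _ Vm.
have oU n : open (U n).
  rewrite /U setDE; apply: openI; first by have [[]] := VP n.
  by apply: closed_openC; have [[]] := VP n.+1.
have covU : \bigcup_n U n = ~` [set x].
  apply/seteqP; split=> [z [n _ [_ Vz]] zx|z zx].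
    by apply: Vz; rewrite zx; have [] := VP n.+1.
  have [n0 Vn0] : exists n, ~ V n z.
    have [|n VnN] := VN (~` [set z]); last by exists n => /VnN/(_ erefl).
    apply: open_nbhs_nbhs; split; last exact: nesym.
    exact: open_setC1.
  elim: n0 Vn0 => [|n IH] Vn; first by case: Vn; rewrite V0.
  by have [/= Vz|/IH//] := pselect (V n z); exists n.
pose U' n := f n @` U n.
have U'U n : U' n `<=` U n.+1 by have [] := fgU n.
have fg n : pair_homeo P (U n) (U' n) (f n) (g n) by have [] := fgU n.
have tU' : trivIset setT U'.
  move=> m n _ _ [z [/U'U Um /U'U Un]]; apply: succn_inj.
  by apply: tU => //; exists z.
have TS := piecewise_homeo tU tU' fg.
set T := piecewise U f in TS; set S := piecewise U' g in TS; rewrite covU in TS.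
have [] := shift_orbit TS _ _ tU covU.
- by rewrite -covU => z [n _ /U'U Uz]; exists n.+1.
- have -> : ~` [set x] `\` \bigcup_n U' n = U 0%N `|` \bigcup_n (U n.+1 `\` U' n).
    apply/seteqP; split=> z.
      rewrite -covU => -[[[|n] _ Uz] U'z]; first by left.
      by right; exists n => //; split=> // U'nz; apply: U'z; exists n.
    move=> zU; have zx : (~` [set x]) z.
      by rewrite -covU; case: zU => [?|[n _ [? _]]]; [exists 0%N|exists n.+1].
    split=> // -[m _ U'z]; case: zU => [Uz|[n _ [Uz nU'z]]].
      suff : 0%N = m.+1 by [].
      by apply: tU => //; exists z; split=> //; exact: U'U.
    apply: nU'z; suff -> : n = m by [].
    by apply: succn_inj; apply: tU => //; exists z; split=> //; exact: U'U.
  apply: openU => //; apply: bigcup_open => n _; rewrite setDE; apply: openI => //.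
  apply: closed_openC; apply: compact_closed => //; apply: continuous_compact.
    apply: continuous_in_subspaceT => z /[!inE] Uz.
    by have [_ _ /(_ z Uz)[]] := fg n.
  apply: subclosed_compact cX _ => //.
  rewrite /U setDE; apply: closedI; first by have [[]] := VP n.
  by apply: open_closedC; have [[]] := VP n.+1.
- move=> n z Uz; rewrite /T (piecewiseE _ tU Uz); apply: U'U; by exists z.
set D := fun m => _; move=> tD covD hD.
have hDD m n : pair_homeomorphic P (D m) (D n).
  exact: pair_homeomorphic_trans (pair_homeomorphic_sym (hD m)) (hD n).
have oD m : open (D m) by have [? [? []]] := hDD m m.
have D0 m : D m !=set0.
  have Dy : D 0%N y.
    rewrite /D image_id; split=> // -[n _ /U'U Uy].
    suff : 0%N = n.+1 by [].
    apply: tU => //; exists y; split=> //; split; first by rewrite V0.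
    by rewrite V1E => /V1y; exact.
  by have [h [_ [_ _ /(_ y Dy)[? _ _ _] _]]] := hDD 0%N m; exists (h y).
(* Each summand consists of infinitely many of the sets [D m], which makes it
   non-compact even when [D 0] is compact. *)
have [b [_ b_inj b_surj]] : exists b : nat * nat -> nat, set_bij setT setT b.
  by apply/card_set_bijP; exact: card_nat2.
pose E j l := D (b (j, l)).
have tE j : trivIset setT (E j).
  move=> l l' _ _ ll'; have /b_inj : b (j, l) = b (j, l') by apply: tD.
  by rewrite !inE => /(_ I I)[].
exists (fun j => \bigcup_l E j l).
  split.
  - by move=> j; apply: bigcup_open => l _; exact: oD.
  - move=> i j _ _ [z [[l _ Ez] [l' _ Ez']]].
    have /b_inj : b (i, l) = b (j, l') by apply: tD => //; exists z.
    by rewrite !inE => /(_ I I)[].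
  - rewrite -covD; apply/seteqP; split=> z; first by move=> [j _ [l _ ?]]; exists (b (j, l)).
    move=> [m _ Dz]; have [[j l] _ bm] := b_surj m I.
    by exists j => //; exists l => //; rewrite /E bm.
  - by move=> i j; apply: bigcup_homeomorphic => // l; exact: hDD.
move=> j cE.
have [|||n En] := @compact_increasing_cover _ _ (fun n => \bigcup_(l in `I_n) E j l) cE.
- by move=> n; apply: bigcup_open => l _; exact: oD.
- by move=> m n mn; apply: bigcup_subset => i /= im; exact: leq_trans mn.
- by move=> z [l _ Ez]; exists l.+1 => //; exists l => /=.
have [z Ez] : E j n !=set0 by exact: D0.
have [|l /= ln Elz] := En z; first by exists n.
have nl : n = l by apply: (tE j) => //; exists z.
by move: ln; rewrite nl ltnn.
Qed.

End SelfSimilarToRadial.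

(** * The space of ends *)

Lemma open_sub_closure_interior (X : topologicalType) (V : set X) :
  open V -> V `<=` interior (closure V).
Proof.
move=> oV x Vx; apply: (interiorS (@subset_closure _ V)).
by rewrite (interior_id _).1.
Qed.

Lemma closed_boundary (X : topologicalType) (A : set X) : closed (boundary A).
Proof.
rewrite /boundary setDE; apply: closedI; first exact: closed_closure.
by apply: open_closedC; exact: open_interior.
Qed.

Section EndSpace.
Context (S : topologicalType).
Implicit Types (V W : set S) (U : exiting_seq S) (e : end_space S).

Lemma end_class_repr e : exists U, e = end_class U.
Proof. by exists (repr e); rewrite /end_class reprK. Qed.

Lemma end_nbhd_class V U : end_nbhd V (end_class U) <-> exists n, U n `<=` V.
Proof.
split=> [[U' [/end_classP UU' [n U'V]]]|UV]; last by exists U.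
have [m [Um _]] := UU' n; exists m; exact: subset_trans U'V.
Qed.

Lemma exit_set_compact_boundary U n : compact_boundary_open (U n).
Proof. by split; [exact: exit_open|exact: exit_boundary]. Qed.

Lemma open_end_nbhd V : compact_boundary_open V -> open (end_nbhd V).
Proof.
by move=> cV; exists [set V]; [move=> _ ->|rewrite bigcup_set1].
Qed.

Lemma nbhs_end e (N : set (end_space S)) : nbhs e N ->
  exists V, [/\ compact_boundary_open V, end_nbhd V e & end_nbhd V `<=` N].
Proof.
rewrite nbhsE => -[_ [[D sD <-] [V DV Ve] DN]].
exists V; split=> //; first exact: sD.
by apply: subset_trans DN => e' Ve'; exists V.
Qed.

(** This is where the connectedness of the terms of exiting sequences enters: a
tail that misses the compact boundary of [V] lies on one side of it, so that
every end lies either in [V] or in the exterior of [V]. *)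
Lemma connected_boundary C V : connected C -> open V ->
  C `&` boundary V = set0 -> C `<=` V \/ C `<=` ~` closure V.
Proof.
move=> conC oV CV; apply: connected_subset conC.
- split; first exact: setICr.
  apply/seteqP; split=> // x [Vx]; rewrite closure_setC; apply.
  exact: open_sub_closure_interior.
move=> x Cx; have [Vx|nVx] := pselect (V x); first by left.
right=> clVx; suff : set0 x by [].
by rewrite -CV; split=> //; split=> //; rewrite (interior_id _).1.
Qed.

Lemma compact_boundary_exterior V : compact_boundary_open V ->
  compact_boundary_open (~` closure V).
Proof.
move=> [oV cV]; split; first by apply: closed_openC; exact: closed_closure.
apply: (@subclosed_compact _ _ (boundary V)) => //.
  exact: closed_boundary.
rewrite /boundary closure_setC interiorC setDE setCK.
move=> x [xV clVx]; split.
  by rewrite (closure_id (closure V)).1//; exact: closed_closure.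
by move=> Vx; apply: xV; apply: interiorS Vx; exact: subset_closure.
Qed.

Lemma end_nbhd_exterior V : compact_boundary_open V ->
  ~` (end_nbhd V) = end_nbhd (~` closure V).
Proof.
move=> [oV cV]; apply/seteqP; split=> e; have [U ->] := end_class_repr e.
  move=> nV; apply/end_nbhd_class.
  have [n Un] := @exit_leaves _ U _ cV; exists n.
  have [UV|//] := connected_boundary (@exit_connected _ U n) oV Un.
  by case: nV; apply/end_nbhd_class; exists n.
move=> /end_nbhd_class[m Um] /end_nbhd_class[n Un].
have [x Ux] := @exit_nonempty _ U (maxn m n).
apply: (Um x); first by apply: exit_le Ux; exact: leq_maxl.
by apply: subset_closure; apply: Un; apply: exit_le Ux; exact: leq_maxr.
Qed.

Lemma clopen_end_nbhd V : compact_boundary_open V -> clopen (end_nbhd V).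
Proof.
move=> cV; split; first exact: open_end_nbhd.
rewrite -[end_nbhd V]setCK; apply: open_closedC; rewrite end_nbhd_exterior//.
exact/open_end_nbhd/compact_boundary_exterior.
Qed.

Lemma end_nbhd_basis e : exists B : nat -> set (end_space S),
  [/\ forall n, clopen (B n), forall n, B n e &
      forall N, nbhs e N -> exists n, B n `<=` N].
Proof.
have [U ->] := end_class_repr e; exists (fun n => end_nbhd (U n)); split.
- by move=> n; apply: clopen_end_nbhd; exact: exit_set_compact_boundary.
- by move=> n; apply/end_nbhd_class; exists n.
- move=> N /nbhs_end[V [_ /end_nbhd_class[n UV] VN]]; exists n.
  apply: subset_trans VN => e'; have [U' ->] := end_class_repr e'.
  move=> /end_nbhd_class[m U'm]; apply/end_nbhd_class; exists m.
  exact: subset_trans UV.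
Qed.

(** Inequivalent sequences [U] and [U'] have, up to exchanging them, a term [U' n]
which contains no term of [U]; then the clopen set of the ends in [U' n]
separates the two ends. *)
Lemma end_space_hausdorff : hausdorff_space (end_space S).
Proof.
have sep (U U' : exiting_seq S) n : (forall m, ~ U m `<=` U' n) ->
    exists A : set (end_space S), [/\ clopen A, A (end_class U') & ~ A (end_class U)].
  move=> nUU'; exists (end_nbhd (U' n)); split.
  - by apply: clopen_end_nbhd; exact: exit_set_compact_boundary.
  - by apply/end_nbhd_class; exists n.
  - by move=> /end_nbhd_class[m /nUU'].
have sep_clopen (e e' : end_space S) : e != e' ->
    exists A : set (end_space S), [/\ clopen A, A e' & ~ A e].
  have [U ->] := end_class_repr e; have [U' ->] := end_class_repr e'.
  move=> ne; apply: contrapT => nosep.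
  have le1 n : exists m, U m `<=` U' n.
    apply: contrapT => /forallNP nU; apply: nosep; exact: sep nU.
  have le2 n : exists m, U' m `<=` U n.
    apply: contrapT => /forallNP nU; apply: nosep.
    have [A [cA Ae Ae']] := sep _ _ _ nU.
    by exists (~` A); split=> //; exact: clopenC.
  move/eqP: ne; apply; apply/end_classP => n.
  have [m Um] := le1 n; have [m' Um'] := le2 n; exists (maxn m m'); split.
    by apply: subset_trans Um; apply: exit_le; exact: leq_maxl.
  by apply: subset_trans Um'; apply: exit_le; exact: leq_maxr.
rewrite open_hausdorff => e e' /sep_clopen[A [[oA cA] Ae' Ae]].
exists (~` A, A) => /=; first by rewrite !inE.
by split=> //; [exact: closed_openC|rewrite setICl].
Qed.

Section Compactness.
Hypothesis conS : connected [set: S].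
Hypothesis hS : hausdorff_space S.
Hypothesis lcS : forall (O : set S) x, open O -> open (connected_component O x).
Variable M : nat -> set S.
Hypothesis cM : forall n, compact (M n).
Hypothesis M_incr : {homo M : m n / (m <= n)%N >-> m `<=` n}.
Hypothesis M_exhaust : forall K, compact K -> exists n, K `<=` interior (M n).

Let openCM n : open (~` M n).
Proof. by apply: closed_openC; exact: compact_closed. Qed.

Let comp n q := connected_component (~` M n) q.

(** A boundary point outside [M n] would have a connected neighbourhood outside
[M n] which meets the component, and would therefore be interior to it. *)
Let comp_boundary n q : compact_boundary_open (comp n q).
Proof.
have oC : open (comp n q) by exact: lcS.
split=> //; apply: (@subclosed_compact _ _ (M n)) => //.
  exact: closed_boundary.
move=> z [clz nz]; apply: contrapT => Mz; apply: nz.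
have [|y [qy zy]] := clz (comp n z).
  apply: open_nbhs_nbhs; split; [exact: lcS|exact: connected_component_refl].
rewrite (interior_id _).1//; apply: connected_component_trans qy _.
exact: connected_component_sym.
Qed.

(** If the component of the complement of [M n] which contains a tail of [e] missed
the boundary of [K], it would stay outside [K]; its closure would then miss
[M n], so it would be closed and hence be all of the connected space [S]. *)
Let component_point n K e : compact K -> K !=set0 -> M n `<=` interior K ->
  exists p, boundary K p /\ end_nbhd (comp n p) e.
Proof.
move=> cK [x0 Kx0] MK; have [U ->] := end_class_repr e.
have [m Um] := @exit_leaves _ U _ cK.
have [u Uu] := @exit_nonempty _ U m.
have UK : U m `<=` ~` K by apply/disjoints_subset.
have KM : ~` K `<=` ~` M n by apply: subsetC => z /MK; exact: interior_subset.
have clK : closed K by exact: compact_closed.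
have bK : boundary (~` K) = boundary K.
  rewrite /boundary closure_setC interiorC -(closure_id _).1//.
  by rewrite !setDE setCK setIC.
have UC : U m `<=` comp n u.
  apply: connected_component_max => //; first exact: subset_trans KM.
  exact: exit_connected.
suff [p [Cp bp]] : (comp n u `&` boundary K) !=set0.
  exists p; split=> //; apply/end_nbhd_class; exists m.
  by rewrite /comp -(same_connected_component Cp).
apply: contrapT => /nonemptyPn; rewrite -bK => C0.
have CK : comp n u `<=` ~` K.
  have [|//|CK] := connected_boundary (@component_connected _ _ u) _ C0.
    exact: closed_openC.
  case: (CK u); first by apply: connected_component_refl; exact/KM/UK.
  by apply: subset_closure; exact: UK.
have oC : open (comp n u) by exact: lcS.
have cC : closed (comp n u).
  move=> z clz; have Mz : (~` M n) z.
    by move=> /MK; move: (closureS CK clz); rewrite closure_setC.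
  have [|y [uy zy]] := clz (comp n z).
    apply: open_nbhs_nbhs; split; [exact: lcS|exact: connected_component_refl].
  by apply: connected_component_trans uy _; exact: connected_component_sym.
suff CT : comp n u = setT by apply: (CK x0) => //; rewrite CT.
apply: conS; first by exists u; exact: UC.
  by exists (comp n u) => //; rewrite setTI.
by exists (comp n u) => //; rewrite setTI.
Qed.

(** Every end [e] has a component of the complement of [M n], and a point [p e] of
it on a compact boundary. If [q] is an accumulation point of [p] along the
ultrafilter, then the component of [q] is a neighbourhood of [q], so it is the
component of [p e] for [e] in a set of the ultrafilter. *)
Let ultra_component n (F : set_system (end_space S)) : UltraFilter F ->
  exists q, ~ M n q /\ F (end_nbhd (comp n q)).
Proof.
move=> FU; have [e _] := filter_ex (@filterT _ F _).
have [U _] := end_class_repr e; have [x0 _] := @exit_nonempty _ U 0.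
have [k MK] := M_exhaust (compactU (@cM n) (@compact_set1 _ x0)).
have MnK : M n `<=` interior (M k) by apply: subset_trans MK; exact: subsetUl.
have Mk0 : M k !=set0.
  by exists x0; apply: interior_subset; apply: MK; right.
have [p pP] := choice (fun e => component_point e (@cM k) Mk0 MnK).
have cB : compact (boundary (M k)).
  apply: (@subclosed_compact _ _ (M k)) => //.
    exact: closed_boundary.
  move=> z []; rewrite -(closure_id _).1//; exact: compact_closed.
have pF : F (p @^-1` boundary (M k)).
  by apply: filterS filterT => e' _; have [] := pP e'.
have [q [[_ nq] cq]] := cB (p @ F) _ pF.
have Mq : ~ M n q by move=> /MnK.
exists q; split=> //.
have [//|FC] := in_ultra_setVsetC (end_nbhd (comp n q)) FU.
have Fp : F (p @^-1` (p @` (~` end_nbhd (comp n q)))).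
  by apply: filterS FC => e' Ce'; exists e'.
have [|_ [[e' Ce' <-] qe']] := cq _ (comp n q) Fp.
  apply: open_nbhs_nbhs; split; [exact: lcS|exact: connected_component_refl].
case: Ce'; have [_] := pP e'.
by rewrite /comp (same_connected_component qe').
Qed.

Lemma end_space_compact : compact [set: end_space S].
Proof.
rewrite compact_ultra => F FU _.
have /choice[q qP] n := ultra_component n FU.
pose C n := comp n (q n).
have CM n : C n `<=` ~` M n by exact: connected_component_sub.
have oC n : open (C n) by exact: lcS.
have Cdecr n : C n.+1 `<=` C n.
  have [_ Fn] := qP n; have [_ Fn1] := qP n.+1.
  have [e []] := filter_ex (filterI Fn Fn1); have [U ->] := end_class_repr e.
  move=> /end_nbhd_class[m Um] /end_nbhd_class[m' Um'].
  have [w Uw] := @exit_nonempty _ U (maxn m m').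
  have Cw : C n w by apply: Um; apply: exit_le Uw; exact: leq_maxl.
  have Cw' : C n.+1 w by apply: Um'; apply: exit_le Uw; exact: leq_maxr.
  rewrite [in X in _ `<=` X]/C /comp (same_connected_component Cw).
  apply: connected_component_max => //; last exact: component_connected.
  by apply: subset_trans (@CM n.+1) _; apply: subsetC; exact: M_incr.
have C0 n : C n !=set0.
  by exists (q n); apply: connected_component_refl; have [] := qP n.
have Cleave K : compact K -> exists n, C n `&` K = set0.
  move=> /M_exhaust[n KM]; exists n; apply/disjoints_subset.
  by apply: subset_trans (@CM n) _; apply: subsetC => z /KM; exact: interior_subset.
pose U := ExitingSeq oC (fun n => (@comp_boundary n (q n)).2)
  (fun n => @component_connected _ _ _) C0 Cdecr Cleave.
exists (end_class U); split=> // N /nbhs_end[V [_ /end_nbhd_class[n CV] VN]].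
have [_ FC] := qP n; apply: filterS FC; apply: subset_trans VN => e.
have [U' ->] := end_class_repr e => /end_nbhd_class[m U'm].
by apply/end_nbhd_class; exists m; exact: subset_trans CV.
Qed.

End Compactness.

End EndSpace.

(** * Topology of surfaces *)

Section Plane.
Context (R : realType).

(** Any two points of a product of two intervals are joined by a horizontal and a
vertical segment inside the product. *)
Lemma plane_connected_box (p : R * R) (W : set (R * R)) : nbhs p W ->
  exists A, [/\ nbhs p A, A `<=` W & connected A].
Proof.
move=> /nbhs_ballP[r r0 rW].
have cb (a : R) : connected (ball a r).
  by rewrite ball_itv; apply/connected_intervalP; exact: interval_is_interval.
have slice1 a : connected ((fun b => (a, b)) @` ball p.2 r : set (R * R)).
  apply: connected_continuous_connected => //; apply: continuous_subspaceT => b.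
  by apply: (@cvg_pair _ _ _ _ (nbhs a) (nbhs b)); [exact: cvg_cst|exact: cvg_id].
have slice2 b : connected ((fun a => (a, b)) @` ball p.1 r : set (R * R)).
  apply: connected_continuous_connected => //; apply: continuous_subspaceT => a.
  by apply: (@cvg_pair _ _ _ _ (nbhs a) (nbhs b)); [exact: cvg_id|exact: cvg_cst].
exists (ball p r); split=> //; first exact: nbhsx_ballx.
suff -> : ball p r = connected_component (ball p r) p by exact: component_connected.
apply/seteqP; split; last exact: connected_component_sub.
move=> [a b] [/= pa pb].
apply: (@connected_component_trans _ _ (p.1, b)).
  exists ((fun b => (p.1, b)) @` ball p.2 r); last by exists b.
  split=> //; first by exists p.2; [exact: ballxx|case: (p)].
  by move=> _ [c pc <-]; split=> //=; exact: ballxx.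
exists ((fun a => (a, b)) @` ball p.1 r); last by exists a.
split=> //; first by exists p.1 => //; exact: ballxx.
by move=> _ [c pc <-]; split.
Qed.

Lemma plane_compact_nbhd (p : R * R) : exists2 K, nbhs p K & compact K.
Proof.
have seg (a : R) : exists2 K, nbhs a K & compact K.
  exists (closed_ball a 1%R); last exact: closed_ballR_compact.
  apply: filterS (nbhsx_ballx a 1%R _) => //; exact: subset_closure.
have [K1 n1 c1] := seg p.1; have [K2 n2 c2] := seg p.2.
exists (K1 `*` K2); last exact: compact_setX.
by exists (K1, K2).
Qed.

End Plane.

Section Manifold.
Context (R : realType) (S : topologicalType).
Hypothesis mS : two_manifold R S.

(** The inverse of a chart maps neighbourhoods to neighbourhoods simply because the
chart is continuous and defined near [x]. *)
Lemma manifold_chart (x : S) : exists (p : R * R) (g : R * R -> S),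
  [/\ continuous g, g p = x & forall W, nbhs p W -> nbhs x (g @` W)].
Proof.
have [_ _ _ charts] := mS.
have [N xN [f [g [fP gP /subspace_continuousP cf cg]]]] := charts x.
have Nx := nbhs_singleton xN.
exists (f x), g; split.
- exact: (continuous_subspace_setT g).2.
- by have [] := fP x Nx.
move=> W /(cf x Nx) fW; apply: filterS2 xN fW => y Ny /(_ Ny) Wfy.
by exists (f y) => //; have [] := fP y Ny.
Qed.

Lemma manifold_locally_connected (O : set S) x :
  open O -> open (connected_component O x).
Proof.
move=> oO; rewrite openE => y Cy.
have [p [g [cg gp gW]]] := manifold_chart y.
have Oy : O y by exact: connected_component_sub Cy.
have [|A [pA AO conA]] := @plane_connected_box _ p (g @^-1` O).
  by apply: cg; rewrite gp; exact: open_nbhs_nbhs.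
rewrite /interior; apply: filterS (gW _ pA).
rewrite (same_connected_component Cy); apply: connected_component_max.
- by exists p => //; exact: nbhs_singleton.
- by move=> _ [q /AO Oq <-].
- apply: connected_continuous_connected => //; exact: continuous_subspaceT.
Qed.

Lemma manifold_locally_compact (x : S) : exists2 K, nbhs x K & compact K.
Proof.
have [p [g [cg _ gW]]] := manifold_chart x.
have [K pK cK] := plane_compact_nbhd p.
exists (g @` K); first exact: gW.
by apply: continuous_compact => //; exact: continuous_subspaceT.
Qed.

(** The members of a countable basis which are contained in compact sets still
cover [S]; [M n] is the union of compact sets containing those among the first
[n]. *)
Lemma manifold_exhaustion : exists M : nat -> set S,
  [/\ forall n, compact (M n), {homo M : m n / (m <= n)%N >-> m `<=` n} &
      forall K, compact K -> exists n, K `<=` interior (M n)].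
Proof.
have [_ [B /countable_injP[c c_inj] [Bopen Bbasis]] _ _] := mS.
have /choice[L LP] n : exists L : set S, compact L /\
    forall U K, B U -> c U = n -> compact K -> U `<=` K -> U `<=` L.
  have [[U [K [BU cU cK UK]]]|no] := pselect (exists U K,
      [/\ B U, c U = n, compact K & U `<=` K]).
    exists K; split=> // U' K' BU' cU' _ _.
    by rewrite (c_inj U' U) ?inE// cU'.
  exists set0; split; first exact: compact0.
  by move=> U K BU cU cK UK; case: no; exists U, K.
pose M n := \bigcup_(i in `I_n) L i.
have Mincr : {homo M : m n / (m <= n)%N >-> m `<=` n}.
  by move=> m n mn; apply: bigcup_subset => i /= im; exact: leq_trans mn.
exists M; split=> //.
  move=> n; rewrite /M bigcup_mkord; apply: bigsetU_compact => i _.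
  by have [] := LP i.
move=> K cK; apply: compact_increasing_cover => //.
- by move=> n; exact: open_interior.
- by move=> m n mn; apply: interiorS; exact: Mincr.
move=> x _; have [N xN cN] := manifold_locally_compact x.
have [U [BU Ux] UN] := Bbasis x N xN.
exists (c U).+1 => //; have UM : U `<=` M (c U).+1.
  have [_ /(_ U N BU erefl cN UN) UL] := LP (c U).
  by move=> y /UL Ly; exists (c U) => /=.
apply: interiorS UM _ _; rewrite (interior_id _).1//; exact: Bopen.
Qed.

End Manifold.

(** * End spaces of surfaces *)

(** For bijections, mapping [A `&` P] onto [B `&` P] amounts to preserving and
reflecting membership in [P] at each point of [A]. *)
Lemma ends_homeomorphicE (R : realType) (S : topologicalType)
    (A B : set (end_space S)) : open A -> open B ->
  ends_homeomorphic R A B <-> pair_homeomorphic (@nonplanar_ends R S) A B.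
Proof.
move=> oA oB; set P := @nonplanar_ends R S; split.
  move=> [f [g [[fP gP cf cg] fAP]]]; exists f, g.
  rewrite continuous_open_subspace// in cf.
  rewrite continuous_open_subspace// in cg.
  split=> // [x Ax|y By]; last first.
    by have [? ?] := gP y By; split=> //; apply: cg; rewrite inE.
  have [Bfx gfx] := fP x Ax; split=> //; last by apply: cf; rewrite inE.
  split=> [Pfx|Px]; last first.
    suff [] : (B `&` P) (f x) by [].
    by rewrite -fAP; exists x.
  have : (B `&` P) (f x) by [].
  rewrite -fAP => -[x' [Ax' Px'] ff]; rewrite -gfx -ff.
  by have [_ ->] := fP x' Ax'.
move=> [f [g [_ _ fP gP]]]; exists f, g; split; first split.
- by move=> x /fP[].
- by move=> y /gP[].
- rewrite continuous_open_subspace// => x /[!inE] Ax.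
  by have [] := fP x Ax.
- rewrite continuous_open_subspace// => x /[!inE] Bx.
  by have [] := gP x Bx.
apply/seteqP; split=> [_ [x [Ax Px] <-]|y [By Py]].
  have [Bfx _ [_ Pfx] _] := fP x Ax.
  by split; [|exact: Pfx].
have [Agy fgy _] := gP y By; have [_ _ [Pgy _] _] := fP _ Agy.
by exists (g y) => //; split=> //; apply: Pgy; rewrite fgy.
Qed.

Theorem theorem5p2 (R : realType) (S : topologicalType)
    (hS : two_manifold R S) (hO : orientable R S) :
  self_similar R S <-> radially_symmetric R S.
Proof.
have [conS _ hausS _] := hS.
have [M [cM M_incr M_exhaust]] := manifold_exhaustion hS.
have lcS := manifold_locally_connected hS.
have cE : compact [set: end_space S] by exact: end_space_compact cM M_incr M_exhaust.
have hE := @end_space_hausdorff S.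
have bE := @end_nbhd_basis S.
set P := @nonplanar_ends R S.
have ssE : self_similar R S <-> pair_self_similar P.
  split=> ss n F cF tF covF; have [i [A]] := ss n F cF tF covF.
    move=> [AF oA hA]; exists i, A; split=> //.
    by apply/ends_homeomorphicE => //; exact: openT.
  move=> [AF hA]; have [_ [_ [oA _ _ _]]] := hA; exists i, A; split=> //.
  by apply/ends_homeomorphicE => //; exact: openT.
rewrite ssE; split=> [ss|[[x xE]|[x [F [hF _ _ [covF tF oF]]]]]].
- have [x sx] := self_similar_star_point cE bE ss.
  have [[y yx]|xE] := pselect (exists y, y <> x); last first.
    left; exists x; apply/seteqP; split=> // y _; apply: contrapT => yx.
    by apply: xE; exists y.
  right; have [F [oF tF covF hF] ncF] := star_point_radial cE hE bE sx yx.
  exists x, F; split=> //.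
  + by move=> n m; apply/ends_homeomorphicE.
  + move=> n m nm; have FF : F n `<=` ~` F m.
      move=> z Fn Fm; move/eqP: nm; apply; apply: tF => //.
      by exists z.
    apply/disjoints_subset; apply: subset_trans (closureS FF) _.
    by rewrite -(closure_id _).1//; exact: open_closedC.
  + split=> // n; exists (F n) => //; apply/esym/setIidPr.
    by rewrite -covF; exact: bigcup_sup.
- move=> n E cEi tE covE; have [i _ Eix] : (\bigcup_i E i) x by rewrite covE.
  exists i, setT; split; first by rewrite xE => _ ->.
  exact/pair_homeomorphic_refl/openT.
- have oFn n : open (F n).
    have [W oW ->] := oF n; apply: openI => //.
    by apply: closed_openC; exact: accessible_closed_set1 (hausdorff_accessible hE) x.
  apply: (@radial_self_similar _ P cE hE x F); split=> //.
  by move=> n m; apply/ends_homeomorphicE.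
Qed.
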